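(* As an identity of formal power series in $q$ (equivalently, for complex $|q|<1$), $$\sum_{m\ge1,\,n\ge1}\frac{q^{m+n}}{(1+q^m)(1+q^n)(1+q^{m+n})}=\sum_{r\ge1}q^{2r}\sum_{k\mid r}k,$$ where the inner sum on the right runs over the positive divisors $k$ of $r$. *)

(* Defs.v *)
From HB Require Import structures.
From mathcomp Require Import all_boot all_order all_algebra.
From mathcomp Require Import boolp classical_sets functions cardinality fsbigop.

Set Implicit Arguments.
Unset Strict Implicit.
Unset Printing Implicit Defensive.

Import GRing.Theory.

Local Open Scope classical_set_scope.
Local Open Scope ring_scope.

(* The ring R[[q]] of formal power series; f n is the coefficient of q^n.     *)
(* The record keeps R[[q]] apart from nat -> R with its pointwise product.    *)
Record fps (R : Type) := Fps { fps_coef :> nat -> R }.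

Lemma fpsP (R : Type) (f g : fps R) : f =1 g -> f = g.
Proof. by case: f g => [f] [g] /= /funext ->. Qed.

HB.instance Definition _ (R : Type) := gen_eqMixin (fps R).
HB.instance Definition _ (R : Type) := gen_choiceMixin (fps R).

Section FpsZmodule.
Variable R : zmodType.
Implicit Types f g h : fps R.

Definition fps_zero : fps R := Fps (fun=> 0).
Definition fps_opp f : fps R := Fps (fun n => - f n).
Definition fps_add f g : fps R := Fps (fun n => f n + g n).

Fact fps_addA : associative fps_add.
Proof. by move=> f g h; apply: fpsP => n /=; rewrite addrA. Qed.

Fact fps_addC : commutative fps_add.
Proof. by move=> f g; apply: fpsP => n /=; rewrite addrC. Qed.

Fact fps_add0 : left_id fps_zero fps_add.
Proof. by move=> f; apply: fpsP => n /=; rewrite add0r. Qed.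

Fact fps_addN : left_inverse fps_zero fps_opp fps_add.
Proof. by move=> f; apply: fpsP => n /=; rewrite addNr. Qed.

HB.instance Definition _ := GRing.isZmodule.Build (fps R)
  fps_addA fps_addC fps_add0 fps_addN.

End FpsZmodule.

Section FpsComNzRing.
Variable R : comNzRingType.
Implicit Types f g h : fps R.

Definition fps_one : fps R := Fps (fun n => (n == 0%N)%:R).
Definition fps_mul f g : fps R :=
  Fps (fun n => \sum_(i < n.+1) f i * g (n - i)%N).

Fact fps_mulC : commutative fps_mul.
Proof.
move=> f g; apply: fpsP => n /=.
rewrite (reindex_inj rev_ord_inj) /=; apply: eq_bigr => i _.
by rewrite subSS mulrC subKn // -ltnS.
Qed.

Fact fps_mulA : associative fps_mul.
Proof.
move=> f g h; apply: fpsP => n /=.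
pose c j k := f j * (g (n - j - k)%N * h k).
transitivity (\sum_(j < n.+1) \sum_(k < n.+1 | (k <= n - j)%N) c j k).
  apply: eq_bigr => j _.
  rewrite -[\sum_(i < _) _]/(fps_mul g h (n - j)%N) fps_mulC /= big_distrr /=.
  rewrite (big_ord_narrow_leq (leq_subr _ _)); apply: eq_bigr => k _.
  by rewrite /c [h _ * _]mulrC.
rewrite (exchange_big_dep predT) //= (reindex_inj rev_ord_inj) /=.
apply: eq_bigr => k _; rewrite subSS.
have le_kn : (k <= n)%N by rewrite -ltnS.
transitivity (\sum_(j < n.+1 | (j <= k)%N) c j (n - k)%N).
  apply: eq_bigl => j; have le_jn : (j <= n)%N by rewrite -ltnS.
  by rewrite leq_sub2lE.
rewrite (big_ord_narrow_leq le_kn) big_distrl /=.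
apply: eq_bigr => j _; rewrite /c mulrA.
have le_jk : (j <= k)%N by rewrite -ltnS.
by rewrite subnAC subKn.
Qed.

Fact fps_mul1 : left_id fps_one fps_mul.
Proof.
move=> f; apply: fpsP => n /=.
rewrite big_ord_recl /= mul1r subn0 big1 ?addr0 // => i _.
by rewrite /bump /= mul0r.
Qed.

Fact fps_mulDl : left_distributive fps_mul +%R.
Proof.
move=> f g h; apply: fpsP => n /=.
by rewrite -big_split /=; apply: eq_bigr => i _; rewrite mulrDl.
Qed.

Fact fps_one_neq0 : fps_one != 0.
Proof.
apply/eqP => /(congr1 (fun f : fps R => f 0%N)) /= /eqP.
by rewrite oner_eq0.
Qed.

HB.instance Definition _ := GRing.Zmodule_isComNzRing.Build (fps R)
  fps_mulA fps_mulC fps_mul1 fps_mulDl fps_one_neq0.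

Definition fps_q : fps R := Fps (fun n => (n == 1%N)%:R).

End FpsComNzRing.

Arguments fps_q {R}.

Section FpsComUnitRing.
Variable R : comUnitRingType.
Implicit Types f g h : fps R.

(* The first n.+1 coefficients b_0, ..., b_n of f^-1, from b_0 = a_0^-1 and   *)
(* b_n = - a_0^-1 * (a_1 * b_(n-1) + ... + a_n * b_0), where a_i = f i.       *)
Fixpoint fps_inv_seq f n : seq R :=
  if n is n'.+1 then
    let s := fps_inv_seq f n' in
    rcons s (- (f 0%N)^-1 * \sum_(i < n) f i.+1 * s`_(n' - i)%N)
  else [:: (f 0%N)^-1].

Definition fps_unit : {pred fps R} := fun f => f 0%N \is a GRing.unit.

Definition fps_inv f : fps R :=
  if fps_unit f then Fps (fun n => (fps_inv_seq f n)`_n) else f.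

Lemma size_fps_inv_seq f n : size (fps_inv_seq f n) = n.+1.
Proof. by elim: n => //= n IHn; rewrite size_rcons IHn. Qed.

Lemma nth_fps_inv_seq f n i :
  (i <= n)%N -> (fps_inv_seq f n)`_i = (fps_inv_seq f i)`_i.
Proof.
elim: n => [|n IHn]; first by rewrite leqn0 => /eqP ->.
rewrite leq_eqVlt => /predU1P[-> //|lt_in].
by rewrite /= nth_rcons size_fps_inv_seq lt_in IHn.
Qed.

Fact fps_mulVf : {in fps_unit, left_inverse 1 fps_inv *%R}.
Proof.
move=> f Uf; rewrite mulrC; apply: fpsP => -[|n]; rewrite /fps_inv ifT //=.
  by rewrite big_ord1 /= divrr.
rewrite big_ord_recl subn0 /= nth_rcons size_fps_inv_seq ltnn eqxx.
rewrite mulrA mulrN divrr // mulN1r addrC; apply/eqP; rewrite subr_eq0.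
apply/eqP/eq_bigr => i _; rewrite /bump /= add1n subSS.
by rewrite [in RHS]nth_fps_inv_seq // leq_subr.
Qed.

Fact fps_unitPl f g : g * f = 1 -> fps_unit f.
Proof.
move=> /(congr1 (fun h : fps R => h 0%N)) /=; rewrite big_ord1 => gf1.
by apply/unitrPr; exists (g 0%N); rewrite mulrC.
Qed.

Fact fps_inv_out : {in [predC fps_unit], fps_inv =1 id}.
Proof. by move=> f nUf; rewrite /fps_inv ifN. Qed.

HB.instance Definition _ := GRing.ComNzRing_hasMulInverse.Build (fps R)
  fps_mulVf fps_unitPl fps_inv_out.

End FpsComUnitRing.

(* Unordered summation in the q-adic sense: each coefficient of the sum is a  *)
(* finite sum.                                                                *)
Definition fps_summable (R : zmodType) (I : choiceType) (D : set I)
    (F : I -> fps R) : Prop :=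
  forall n, finite_set [set i | D i /\ F i n <> 0].

(* Meaningful only when F is summable over D: \sum_(i \in D) is 0 when the    *)
(* support is infinite.                                                       *)
Definition fps_sum (R : zmodType) (I : choiceType) (D : set I)
    (F : I -> fps R) : fps R :=
  Fps (fun n => \sum_(i \in D) F i n).

(* Main.v *)
Require Import Defs.
From mathcomp Require Import all_boot all_order all_algebra.
From mathcomp Require Import boolp classical_sets functions cardinality fsbigop.
From mathcomp Require Import zify ring.

Import GRing.Theory.

Local Open Scope classical_set_scope.
Local Open Scope ring_scope.

(** For m, n >= 1 put x = q^m, y = q^n and g(x) = x / (1 - x^2), the sum of
    the odd powers of x.  The summand splits as
      xy / ((1 + x)(1 + y)(1 + xy)) = g(x) g(y) - g(xy) g(y) - g(xy) g(x)
    ([kernel_split]).  Since xy = q^(m+n), the change of variables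
    (m, n) -> (m + n, n) turns the second term, summed over all pairs, into
    the sum of g(q^m) g(q^n) over n < m, and the third term is likewise the
    sum over m < n.  Only the diagonal survives ([sum_offdiag_cancel]), namely
      sum_n g(q^n)^2 = sum_n q^(2n) / (1 - q^(2n))^2 = sum_n sum_k k q^(2nk),
    and collecting the terms with nk = r gives the divisor sum
    ([coef_odd_geom_sqr], [sum_codivisors_even]).

    Every rearrangement is made on the coefficient of q^N for a fixed N: a
    term with index (m, n) is divisible by q^(m+n), so only the indices in
    1..N contribute and all sums are finite. *)

Lemma fps_coefD (R : zmodType) (f g : fps R) n : (f + g) n = f n + g n.
Proof. by []. Qed.

Lemma fps_coefB (R : zmodType) (f g : fps R) n : (f - g) n = f n - g n.
Proof. by []. Qed.

Lemma fps_coefMn (R : zmodType) (f : fps R) k n : (f *+ k) n = f n *+ k.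
Proof. by elim: k => [|k IHk] //; rewrite !mulrS fps_coefD IHk. Qed.

Lemma fps_coef_qXM (R : comNzRingType) d (f : fps R) n :
  (fps_q ^+ d * f) n = if (n < d)%N then 0 else f (n - d)%N.
Proof.
have coef_qM (h : fps R) k : (fps_q * h) k = if k is k'.+1 then h k' else 0.
  rewrite /GRing.mul /=; case: k => [|k]; first by rewrite big_ord1 mul0r.
  rewrite 2!big_ord_recl /= mul0r add0r mul1r subSS subn0 big1 ?addr0 // => i _.
  by rewrite mul0r.
elim: d n => [|d IHd] n; first by rewrite expr0 mul1r ltn0 subn0.
by rewrite exprS -mulrA coef_qM; case: n => [|n] //; rewrite IHd ltnS subSS.
Qed.

Lemma fps_coef_qX (R : comNzRingType) d n :
  (fps_q ^+ d : fps R) n = (n == d)%:R.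
Proof.
rewrite -[_ ^+ d]mulr1 fps_coef_qXM; case: ltngtP => [//|lt_dn|->] /=.
  by rewrite subn_eq0 leqNgt lt_dn.
by rewrite subnn.
Qed.

Lemma unit_1BqX (R : comUnitRingType) d :
  (0 < d)%N -> 1 - fps_q ^+ d \is a @GRing.unit (fps R).
Proof.
case: d => // d _; change (fps_unit (1 - fps_q ^+ d.+1 : fps R)).
by rewrite /fps_unit fps_coefB fps_coef_qX subr0 unitr1.
Qed.

Lemma fps_summable_seq (R : zmodType) (I : choiceType) (D : set I)
    (F : I -> fps R) (s : nat -> seq I) :
    (forall n i, D i -> i \notin s n -> F i n = 0) ->
  fps_summable D F.
Proof.
move=> Fs n; apply: (@sub_finite_set _ _ [set` s n]); last exact: finite_seq.
by move=> i /= [Di /eqP]; apply: contraR => /(Fs _ _ Di) ->.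
Qed.

Lemma fps_sum_seq (R : zmodType) (I : choiceType) (D : set I)
    (F : I -> fps R) n (s : seq I) :
    uniq s -> {in s, forall i, D i} ->
    (forall i, D i -> i \notin s -> F i n = 0) ->
  fps_sum D F n = \sum_(i <- s) F i n.
Proof.
move=> Us sD Fs; rewrite /= (fsbigE s) //.
rewrite big_seq_cond [RHS]big_seq; apply: eq_bigl => i.
by case: (boolP (i \in s)) => //= /sD Di; rewrite mem_set.
Qed.

(** The closed form of x + x^3 + x^5 + ... *)
Definition odd_geom {A : unitRingType} (x : A) : A := x / (1 - x ^+ 2).

(** Over the common denominator (1 - x^2)(1 - y^2)(1 - x^2y^2) both sides have
    the numerator xy(1 - x)(1 - y)(1 - xy).  In terms of expansions, x^a y^b
    occurs on the left with sign (-1)^(a+b) when min(a, b) is odd: the pairs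
    with a and b both odd give g(x) g(y), and those with an even entry exceeding
    an odd one give the two subtracted terms. *)
Lemma kernel_split (A : comUnitRingType) (x y : A) :
    1 - x ^+ 2 \is a GRing.unit -> 1 - y ^+ 2 \is a GRing.unit ->
    1 - (x * y) ^+ 2 \is a GRing.unit ->
  x * y / ((1 + x) * (1 + y) * (1 + x * y)) =
    odd_geom x * odd_geom y - odd_geom (x * y) * odd_geom y -
    odd_geom (x * y) * odd_geom x.
Proof.
have factor (z : A) : 1 - z ^+ 2 = (1 + z) * (1 - z) by ring.
have inv1D (z : A) : 1 - z ^+ 2 \is a GRing.unit ->
    1 + z \is a GRing.unit /\ (1 + z)^-1 = (1 - z) / (1 - z ^+ 2).
  rewrite factor unitrM => /andP[Uz Uz']; split=> //.
  by rewrite invrM // mulrA divrr // mul1r.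
move=> Ux Uy Uxy.
have [Ux1 ix] := inv1D _ Ux; have [Uy1 iy] := inv1D _ Uy.
have [Uxy1 ixy] := inv1D _ Uxy.
rewrite !invrM ?unitrM ?Ux1 ?Uy1 // ix iy ixy /odd_geom.
move: (mulrV Ux) (mulrV Uy) (mulrV Uxy).
move: (1 - x ^+ 2)^-1 (1 - y ^+ 2)^-1 (1 - (x * y) ^+ 2)^-1 => a b c ha hb hc.
(* Each term is multiplied by the factor 1 that brings it over abc. *)
transitivity (x * a * (y * b) * ((1 - (x * y) ^+ 2) * c)
  - x * y * c * (y * b) * ((1 - x ^+ 2) * a)
  - x * y * c * (x * a) * ((1 - y ^+ 2) * b)); first by ring.
by rewrite ha hb hc !mulr1.
Qed.

(** With w = q^(2m) the square is w / (1 - w)^2, the sum of k w^k over k >= 1.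
    The proof multiplies the expected series [h] by 1 - w twice: the first
    product is w + w^2 + w^3 + ..., the second is w. *)
Lemma coef_odd_geom_sqr (R : comUnitRingType) m n : (0 < m)%N ->
  (odd_geom (fps_q ^+ m : fps R) ^+ 2) n =
    if (2 * m %| n)%N then (n %/ (2 * m))%:R else 0.
Proof.
move=> m_gt0; have: (0 < 2 * m)%N by lia.
rewrite /odd_geom -exprM [(m * 2)%N]mulnC expr_div_n -exprM [(m * 2)%N]mulnC.
move: (2 * m)%N => d d_gt0.
pose h : fps R := Fps (fun k => if (d %| k)%N then (k %/ d)%:R else 0).
pose e : fps R := Fps (fun k => ((0 < k)%N && (d %| k)%N)%:R).
have Ud := unit_1BqX R d d_gt0.
suff -> : fps_q ^+ d / (1 - fps_q ^+ d) ^+ 2 = h by [].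
have he : h * (1 - fps_q ^+ d) = e.
  apply: fpsP => k; rewrite mulrBr mulr1 [h * _]mulrC fps_coefB fps_coef_qXM /=.
  case: ltnP => [lt_kd|le_dk].
    rewrite divn_small // subr0 if_same; case: posnP => //= k_gt0.
    by rewrite gtnNdvd.
  rewrite (leq_trans d_gt0 le_dk) /= dvdn_subl ?dvdnn //.
  case: dvdnP => [[j def_k]|_]; last by rewrite /= subr0.
  move: le_dk; rewrite {k}def_k; case: j => [/(leq_trans d_gt0)|j _] //.
  by rewrite mulSn addKn -mulSn !mulnK // -[j.+1]addn1 natrD addrC addKr.
have ee : e * (1 - fps_q ^+ d) = fps_q ^+ d.
  apply: fpsP => k; rewrite mulrBr mulr1 [e * _]mulrC fps_coefB fps_coef_qXM /=.
  rewrite fps_coef_qX; case: (ltngtP k d) => /= [lt_kd|lt_dk|->].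
  - by rewrite subr0; case: posnP => //= k_gt0; rewrite gtnNdvd.
  - rewrite (ltn_trans d_gt0 lt_dk) subn_gt0 lt_dk /=.
    by rewrite (dvdn_subl (ltnW lt_dk)) ?dvdnn // subrr.
  - by rewrite subnn d_gt0 dvdnn subr0.
by rewrite -{1}ee -he -[h * _ * _]mulrA -expr2 mulrK ?unitrX.
Qed.

(** Reindexing by (m, n) -> (m + n, n), which maps the pairs of positive
    integers onto those with n < m; the pairs leaving the box 1..N contribute
    nothing by hypothesis. *)
Lemma sum_fold_triangle (V : zmodType) (c : nat -> nat -> V) N :
    (forall m n, (N < m)%N -> c m n = 0) ->
  \sum_(1 <= m < N.+1) \sum_(1 <= n < N.+1) c (m + n)%N n =
  \sum_(1 <= m < N.+1) \sum_(1 <= n < N.+1 | (n < m)%N) c m n.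
Proof.
move=> c0; rewrite exchange_big /= [RHS](exchange_big_dep_nat predT) //=.
apply: eq_big_nat => n /andP[n_gt0 le_nN].
rewrite -[RHS](big_nat_widenl n.+1 1 N.+1 predT (c^~ n)) //.
have -> : \sum_(1 <= m < N.+1) c (m + n)%N n =
          \sum_(n.+1 <= m < N.+1 + n) c m n.
  by rewrite -[n.+1]add1n big_addn addnK.
rewrite (@big_cat_nat _ _ _ N.+1 n.+1 (N.+1 + n)) ?leq_addr //=.
rewrite [X in _ + X]big_nat [X in _ + X]big1 ?addr0 // => m /andP[lt_Nm _].
exact: c0.
Qed.

(** By the reindexing the two subtracted sums are the parts n < m and m < n of
    the sum of [c m n] over the box; symmetry of [c] gives the second. *)
Lemma sum_offdiag_cancel (V : zmodType) (c : nat -> nat -> V) N :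
    (forall m n, c m n = c n m) -> (forall m n, (N < m)%N -> c m n = 0) ->
  \sum_(1 <= m < N.+1) \sum_(1 <= n < N.+1)
    (c m n - c (m + n)%N n - c (m + n)%N m) = \sum_(1 <= m < N.+1) c m m.
Proof.
move=> cC c0.
under eq_bigr => m _ do rewrite !sumrB.
rewrite !sumrB sum_fold_triangle //.
have -> : \sum_(1 <= m < N.+1) \sum_(1 <= n < N.+1) c (m + n)%N m =
          \sum_(1 <= m < N.+1) \sum_(1 <= n < N.+1 | (m < n)%N) c m n.
  rewrite exchange_big [RHS](exchange_big_dep_nat predT) //=.
  under eq_bigr => n _ do under eq_bigr => m _ do rewrite addnC.
  rewrite sum_fold_triangle //.
  by apply: eq_bigr => m _; apply: eq_bigr => n _; apply: cC.
rewrite -!sumrB; apply: eq_big_nat => m /andP[m_gt0 le_mN].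
rewrite (bigID (fun n => (n < m)%N)) /= [X in X - _ - _]addrC addrK.
rewrite (bigID (fun n => (m < n)%N)) /=.
rewrite [X in _ - X](eq_bigl (fun n => ~~ (n < m)%N && (m < n)%N)); last first.
  by move=> n; rewrite -leqNgt; case: ltngtP.
rewrite [X in X - _]addrC addrK (eq_bigl (fun n => n == m)); last first.
  by move=> n; case: ltngtP.
by rewrite big_nat1_eq m_gt0 le_mN.
Qed.

(** Both sums run over the divisors of [r], exchanged by n -> r / n. *)
Lemma sum_codivisors (r N : nat) : (0 < r <= N)%N ->
  (\sum_(1 <= n < N.+1 | n %| r) r %/ n = \sum_(k <- divisors r) k)%N.
Proof.
move=> /andP[r_gt0 le_rN].
have mem_div n : (n \in divisors r) = (n %| r)%N by rewrite dvdn_divisors.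
rewrite -big_filter (perm_big (divisors r)); last first.
  apply: uniq_perm; rewrite ?filter_uniq ?iota_uniq ?divisors_uniq // => n.
  rewrite mem_filter mem_index_iota mem_div andbC.
  case: (boolP (n %| r)%N) => [n_r|_]; last by rewrite andbF.
  by rewrite (dvdn_gt0 r_gt0 n_r) ltnS (leq_trans (dvdn_leq r_gt0 n_r) le_rN).
have codivK n : (n %| r)%N -> (r %/ (r %/ n) = n)%N.
  by move=> n_r; rewrite divnA // mulnC mulnK.
have codiv n : (n %| r)%N -> (r %/ n %| r)%N.
  by move=> n_r; rewrite -{2}(divnK n_r) dvdn_mulr.
rewrite -(big_map (fun n => r %/ n)%N predT id); apply/perm_big/uniq_perm.
- rewrite map_inj_in_uniq ?divisors_uniq // => m n; rewrite !mem_div => m_r n_r.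
  by move=> eq_mn; rewrite -(codivK m m_r) eq_mn codivK.
- exact: divisors_uniq.
- move=> k; rewrite mem_div; apply/mapP/idP => [[n + ->]|k_r].
    by rewrite mem_div => /codiv.
  by exists (r %/ k)%N; rewrite ?mem_div ?codiv ?codivK.
Qed.

(** Both sides vanish for odd N.  For N = 2r > 0 the left side is the sum of r/n
    over n dividing r and the right side has the single index r; for N = 0
    both sums are empty. *)
Lemma sum_codivisors_even (R : pzSemiRingType) N :
  \sum_(1 <= n < N.+1) (if (2 * n %| N)%N then (N %/ (2 * n))%:R else 0 : R) =
  \sum_(1 <= r < N.+1 | (2 * r)%N == N) (\sum_(k <- divisors r) k)%:R.
Proof.
case: (boolP (2 %| N)%N) => [/dvdnP[r ->]|odd_N]; last first.
  rewrite !big1 // => n.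
    by move/eqP=> def_N; rewrite -def_N dvdn_mulr in odd_N.
  by rewrite ifN //; apply: contra odd_N; apply: dvdn_trans; apply: dvdn_mulr.
rewrite [(r * 2)%N]mulnC.
rewrite [RHS](eq_bigl (fun i => i == r)) ?big_nat1_eq => [|i]; last first.
  by rewrite eqn_pmul2l.
under [LHS]eq_bigr => n _ do rewrite dvdn_pmul2l // divnMl //.
rewrite -big_mkcond -natr_sum /=.
have [->|r_gt0] := posnP r; first by rewrite muln0 big_geq.
have le_r2r : (0 < r <= 2 * r)%N by lia.
by rewrite sum_codivisors // ifT //; lia.
Qed.

Theorem mainTheorem10 (R : comUnitRingType) :
  let q : fps R := fps_q in
  let D : set (nat * nat) := [set p | (1 <= p.1)%N /\ (1 <= p.2)%N] in
  let F (p : nat * nat) : fps R :=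
    q ^+ (p.1 + p.2) /
      ((1 + q ^+ p.1) * (1 + q ^+ p.2) * (1 + q ^+ (p.1 + p.2))) in
  let E : set nat := [set r | (1 <= r)%N] in
  let G (r : nat) : fps R :=
    q ^+ (2 * r) * (\sum_(k <- divisors r) k)%:R in
  [/\ fps_summable D F, fps_summable E G & fps_sum D F = fps_sum E G].
Proof.
move=> q D F E G.
pose s N := index_iota 1 N.+1.
have F0 N p : D p -> p \notin [seq (m, n) | m <- s N, n <- s N] -> F p N = 0.
  case: p => m n [m_gt0 n_gt0]; rewrite /F /q fps_coef_qXM /=.
  case: ltnP => // le_mnN; rewrite allpairs_f // mem_index_iota.
  - by move: m_gt0 n_gt0 => /=; lia.
  - by move: m_gt0 n_gt0 => /=; lia.
have G0 N r : E r -> r \notin s N -> G r N = 0.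
  move=> r_gt0; rewrite mem_index_iota /G /q fps_coef_qXM => rN.
  by rewrite ifT //; move: rN r_gt0; rewrite /E /=; lia.
split; [exact: fps_summable_seq F0 | exact: fps_summable_seq G0 |].
apply: fpsP => N.
rewrite (fps_sum_seq _ _ _ _ _ _ _ _ (F0 N)); last 2 first.
- by apply: allpairs_uniq; rewrite ?iota_uniq // => -[? ?] [? ?].
- move=> _ /allpairsP[[m n] [/= + + ->]]; rewrite !mem_index_iota /D /=; lia.
rewrite (fps_sum_seq _ _ _ _ _ _ _ _ (G0 N)) ?iota_uniq //; last first.
  by move=> r; rewrite mem_index_iota => /andP[].
rewrite big_allpairs_dep.
pose c m n := (odd_geom (q ^+ m) * odd_geom (q ^+ n)) N.
have Uq m : (0 < m)%N -> 1 - (q ^+ m) ^+ 2 \is a GRing.unit.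
  by move=> m_gt0; rewrite -exprM unit_1BqX // muln_gt0 m_gt0.
transitivity (\sum_(1 <= m < N.+1) \sum_(1 <= n < N.+1)
    (c m n - c (m + n)%N n - c (m + n)%N m)).
  apply: eq_big_nat => m /andP[m_gt0 _]; apply: eq_big_nat => n /andP[n_gt0 _].
  have -> : F (m, n) = odd_geom (q ^+ m) * odd_geom (q ^+ n) -
      odd_geom (q ^+ (m + n)) * odd_geom (q ^+ n) -
      odd_geom (q ^+ (m + n)) * odd_geom (q ^+ m).
    by rewrite /F /= exprD kernel_split -?exprD ?Uq ?addn_gt0 ?m_gt0.
  by rewrite !fps_coefB.
rewrite sum_offdiag_cancel => [|m n|m n lt_Nm]; first last.
- by rewrite /c /odd_geom /q -!mulrA fps_coef_qXM lt_Nm.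
- by rewrite /c mulrC.
transitivity (\sum_(1 <= n < N.+1)
    if (2 * n %| N)%N then (N %/ (2 * n))%:R else 0 : R).
  apply: eq_big_nat => n /andP[n_gt0 _].
  by rewrite /c /q -expr2 coef_odd_geom_sqr.
transitivity (\sum_(1 <= r < N.+1 | (2 * r)%N == N)
    (\sum_(k <- divisors r) k)%:R : R); last first.
  rewrite big_mkcond; apply: eq_bigr => r _.
  rewrite /G /q fps_coef_qXM -[_%:R]/(1 *+ _) fps_coefMn /=.
  case: ltngtP => // [lt_2rN|->]; last by rewrite subnn.
  by rewrite subn_eq0 leqNgt lt_2rN mul0rn.
exact: sum_codivisors_even.
Qed.
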